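(* Let $(H,\alpha)$ be a monoidal Hom-Hopf algebra over a commutative ring $k$. Then the category ${}_{H}\widetilde{\mathcal{H}}(\mathcal{M}_k)^{H}_{H}$ of right-covariant $(H,\alpha)$-Hom-bimodules is a tensor category, with unit object $(H,\alpha)$, tensor product $(M\otimes_HN,\mu\otimes_H\nu)$ of $(M,\mu)$ and $(N,\nu)$ with structure maps $$h(m\otimes_Hn)=\alpha^{-1}(h)m\otimes_H\nu(n),\quad(m\otimes_Hn)h=\mu(m)\otimes_Hn\alpha^{-1}(h),\quad\sigma(m\otimes_Hn)=(m_{[0]}\otimes_Hn_{[0]})\otimes m_{[1]}n_{[1]},$$ associativity constraint $\tilde a_{M,N,P}((m\otimes_Hn)\otimes_Hp)=\mu(m)\otimes_H(n\otimes_H\pi^{-1}(p))$ (for $(P,\pi)$), left unit constraint $\tilde l_M:H\otimes_HM\to M$, $h\otimes_Hm\mapsto hm$, and right unit constraint $\tilde r_M:M\otimes_HH\to M$, $m\otimes_Hh\mapsto mh$.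
   Context: Conventions: $k$ is a commutative ring, $\otimes=\otimes_k$, Sweedler notation without summation signs. $\widetilde{\mathcal{H}}(\mathcal{M}_k)$ is the category of pairs $(M,\mu)$, $M$ a $k$-module, $\mu$ a $k$-linear automorphism of $M$; morphisms $f:(M,\mu)\to(N,\nu)$ are $k$-linear maps with $\nu f=f\mu$; $(M,\mu)\otimes(N,\nu)=(M\otimes N,\mu\otimes\nu)$. A monoidal Hom-Hopf algebra $(H,\alpha)$ is an object of $\widetilde{\mathcal{H}}(\mathcal{M}_k)$ with a $k$-bilinear product, an element $1_H$, and $k$-linear maps $\Delta(h)=h_1\otimes h_2$, $\varepsilon:H\to k$, $S:H\to H$ (antipode) such that $\alpha(ab)=\alpha(a)\alpha(b)$, $\alpha(1_H)=1_H$, $\alpha(a)(bc)=(ab)\alpha(c)$, $a1_H=1_Ha=\alpha(a)$; $\Delta(\alpha(c))=\alpha(c_1)\otimes\alpha(c_2)$, $\varepsilon\alpha=\varepsilon$, $\alpha^{-1}(c_1)\otimes\Delta(c_2)=c_{11}\otimes(c_{12}\otimes\alpha^{-1}(c_2))$, $c_1\varepsilon(c_2)=\alpha^{-1}(c)=\varepsilon(c_1)c_2$; $\Delta(ab)=\Delta(a)\Delta(b)$, $\Delta(1_H)=1_H\otimes1_H$, $\varepsilon(ab)=\varepsilon(a)\varepsilon(b)$, $\varepsilon(1_H)=1$; $S\alpha=\alpha S$ and $S(h_1)h_2=\varepsilon(h)1_H=h_1S(h_2)$. All actions and coactions are morphisms in $\widetilde{\mathcal{H}}(\mathcal{M}_k)$.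 Hom-bimodule $(M,\mu)$: $\alpha(g)(hm)=(gh)\mu(m)$, $1_Hm=\mu(m)$, $(mg)\alpha(h)=\mu(m)(gh)$, $m1_H=\mu(m)$, $(gm)\alpha(h)=\alpha(g)(mh)$. Right Hom-comodule, $\sigma(m)=m_{[0]}\otimes m_{[1]}$: $\mu^{-1}(m_{[0]})\otimes\Delta(m_{[1]})=m_{[0][0]}\otimes(m_{[0][1]}\otimes\alpha^{-1}(m_{[1]}))$, $m_{[0]}\varepsilon(m_{[1]})=\mu^{-1}(m)$. A right-covariant $(H,\alpha)$-Hom-bimodule is a Hom-bimodule with a right Hom-coaction $\sigma$ such that $\sigma((hm)\alpha(g))=\Delta(\alpha(h))(\sigma(m)\Delta(g))$ (componentwise actions). Morphisms are morphisms in $\widetilde{\mathcal{H}}(\mathcal{M}_k)$ that are $H$-linear on both sides and right $H$-colinear. $(H,\alpha)$ is a right-covariant Hom-bimodule via its product and coproduct. For a right Hom-module $(M,\mu)$ and left Hom-module $(N,\nu)$, $M\otimes_HN$ is the coequalizer of $(m\otimes h)\otimes n\mapsto mh\otimes n$ and $(m\otimes h)\otimes n\mapsto\mu(m)\otimes h\nu^{-1}(n)$, i.e. the quotient of $M\otimes N$ by the relations $mh\otimes n=\mu(m)\otimes h\nu^{-1}(n)$. *)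

(* Defs.v *)
From HB Require Import structures.
From mathcomp Require Import all_boot all_order all_algebra.
From mathcomp Require Import finmap monalg boolp.

Set Implicit Arguments.
Unset Strict Implicit.
Unset Printing Implicit Defensive.

Import GRing.Theory.
Import Quotient.
Local Open Scope ring_scope.
Local Open Scope quotient_scope.

Reserved Notation "x ⊗ y" (at level 40, left associativity).
Reserved Notation "x ⊗[ M , N ] y"
  (at level 40, left associativity, format "x  ⊗[ M ,  N ]  y").
Reserved Notation "\tsum_ ( x , y '<-' t ) F"
  (at level 41, F at level 41, x binder, y binder,
   format "'[' \tsum_ ( x ,  y  '<-'  t ) '/  '  F ']'").

(* [GRing.Lmodule] needs only a [comPzRingType], so that [k] may be the zero
   ring; this is why [{bilinear _ -> _ -> _}] and the module structure of
   [{malg k[X]}], which both require [1 != 0], are not used below. *)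

Definition bilinear_map (k : comPzRingType) (U V W : lmodType k)
    (f : U -> V -> W) : Prop :=
  (forall v, linear (f^~ v)) /\ (forall u, linear (f u)).

Section QuotientModule.
Variables (k : pzRingType) (V : lmodType k).

Inductive submod_gen (S : V -> Prop) : V -> Prop :=
| submod_gen_zero : submod_gen S 0
| submod_gen_step c x y : S x -> submod_gen S y -> submod_gen S (c *: x + y).

Variable S : V -> Prop.

Lemma submod_genD x y : submod_gen S x -> submod_gen S y -> submod_gen S (x + y).
Proof.
move=> Sx Sy; elim: Sx => [|c {}x z Sx _ IH]; first by rewrite add0r.
by rewrite -addrA; apply: submod_gen_step.
Qed.

Lemma submod_genZ c x : submod_gen S x -> submod_gen S (c *: x).
Proof.
elim=> [|d {}x y Sx _ IH]; first by rewrite scaler0; apply: submod_gen_zero.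
by rewrite scalerDr scalerA; apply: submod_gen_step.
Qed.

Lemma mem_submod_gen x : S x -> submod_gen S x.
Proof.
move=> Sx; rewrite -[x]scale1r -[_ *: _]addr0.
apply: submod_gen_step Sx _; exact: submod_gen_zero.
Qed.

Definition submod_gen_pred : {pred V} := fun x => `[< submod_gen S x >].

Lemma submod_gen_zmod_closed : zmod_closed submod_gen_pred.
Proof.
split=> [|x y /asboolP Sx /asboolP Sy]; apply/asboolP; first exact: submod_gen_zero.
by apply: submod_genD => //; rewrite -scaleN1r; apply: submod_genZ.
Qed.

HB.instance Definition _ :=
  GRing.isZmodClosed.Build V submod_gen_pred submod_gen_zmod_closed.

Definition quotmod : Type := {quot submod_gen_pred}.
HB.instance Definition _ := GRing.Zmodule.on quotmod.
HB.instance Definition _ := EqQuotient.on quotmod.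

Definition quotmk (x : V) : quotmod := \pi_quotmod x.

Lemma quotmkP x y : quotmk x = quotmk y <-> submod_gen S (x - y).
Proof.
split=> [E|Sxy]; last by apply/eqP; rewrite piE equivE; apply/asboolP.
by apply/asboolP; move/eqP: E; rewrite piE equivE.
Qed.

Lemma quotmk_repr x : quotmk (repr x) = x. Proof. exact: reprK. Qed.

Lemma quotmkD x y : quotmk (x + y) = quotmk x + quotmk y.
Proof. by rewrite /quotmk !piE. Qed.

Definition quotmod_scale (c : k) (x : quotmod) : quotmod := quotmk (c *: repr x).

Lemma quotmod_scaleE c x : quotmod_scale c (quotmk x) = quotmk (c *: x).
Proof. by apply/quotmkP; rewrite -scalerBr; apply/submod_genZ/quotmkP/quotmk_repr. Qed.

Fact quotmod_scaleA a b x :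
  quotmod_scale a (quotmod_scale b x) = quotmod_scale (a * b) x.
Proof. by rewrite -[x]quotmk_repr !quotmod_scaleE scalerA. Qed.
Fact quotmod_scale1 : left_id 1 quotmod_scale.
Proof. by move=> x; rewrite -[x]quotmk_repr quotmod_scaleE scale1r. Qed.
Fact quotmod_scaleDr : right_distributive quotmod_scale +%R.
Proof.
move=> a x y; rewrite -[x]quotmk_repr -[y]quotmk_repr -quotmkD !quotmod_scaleE.
by rewrite scalerDr quotmkD.
Qed.
Fact quotmod_scaleDl x : {morph quotmod_scale^~ x : a b / a + b}.
Proof.
by move=> a b; rewrite -[x]quotmk_repr !quotmod_scaleE scalerDl quotmkD.
Qed.

HB.instance Definition _ := GRing.Zmodule_isLmodule.Build k quotmod
  quotmod_scaleA quotmod_scale1 quotmod_scaleDr quotmod_scaleDl.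

Lemma quotmk_is_linear : linear quotmk.
Proof.
by move=> c x y; rewrite quotmkD; congr (_ + _); rewrite -quotmod_scaleE.
Qed.
HB.instance Definition _ := GRing.isLinear.Build k V quotmod _ quotmk quotmk_is_linear.

End QuotientModule.

Section FreeModule.
Variables (k : pzRingType) (X : choiceType).

Definition freemod : Type := {malg k[X]}.
HB.instance Definition _ := GRing.Zmodule.on freemod.

Definition freemod_scale (c : k) (g : freemod) : freemod :=
  [malg x in msupp g => c * g@_x].

Lemma freemod_scaleE c (g : freemod) x : (freemod_scale c g)@_x = c * g@_x.
Proof.
by rewrite mcoeffE; case: ifPn => // /mcoeff_outdom ->; rewrite mulr0.
Qed.

Fact freemod_scaleA a b g :
  freemod_scale a (freemod_scale b g) = freemod_scale (a * b) g.
Proof. by apply/malgP => x; rewrite !freemod_scaleE mulrA. Qed.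
Fact freemod_scale1 : left_id 1 freemod_scale.
Proof. by move=> g; apply/malgP => x; rewrite freemod_scaleE mul1r. Qed.
Fact freemod_scaleDr : right_distributive freemod_scale +%R.
Proof.
by move=> a g h; apply/malgP => x; rewrite mcoeffD !freemod_scaleE mcoeffD mulrDr.
Qed.
Fact freemod_scaleDl g : {morph freemod_scale^~ g : a b / a + b}.
Proof.
by move=> a b; apply/malgP => x; rewrite mcoeffD !freemod_scaleE mulrDl.
Qed.

HB.instance Definition _ := GRing.Zmodule_isLmodule.Build k freemod
  freemod_scaleA freemod_scale1 freemod_scaleDr freemod_scaleDl.

Definition freegen (x : X) : freemod := << 1 *g x >>.

Definition freelift (P : lmodType k) (f : X -> P) (g : freemod) : P :=
  \sum_(x <- msupp g) g@_x *: f x.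

Lemma freeliftEw (P : lmodType k) (f : X -> P) (D : {fset X}) (g : freemod) :
  (msupp g `<=` D)%fset -> freelift f g = \sum_(x <- D) g@_x *: f x.
Proof.
move=> sgD; rewrite /freelift.
rewrite (big_fset_incl _ sgD) // => x _ /mcoeff_outdom ->; exact: scale0r.
Qed.

Lemma freelift_is_linear (P : lmodType k) (f : X -> P) : linear (freelift f).
Proof.
move=> c g h; pose D := (msupp g `|` msupp h)%fset.
have sub : (msupp (c *: g + h) `<=` D)%fset.
  apply/fsubsetP => x; rewrite -mcoeff_neq0 in_fsetU mcoeffD freemod_scaleE.
  apply: contraR; rewrite negb_or => /andP[/mcoeff_outdom -> /mcoeff_outdom ->].
  by rewrite mulr0 addr0.
rewrite (freeliftEw f sub) (freeliftEw f (fsubsetUl _ _ : msupp g `<=` D)%fset).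
rewrite (freeliftEw f (fsubsetUr _ _ : msupp h `<=` D)%fset).
rewrite scaler_sumr -big_split; apply: eq_bigr => x _ /=.
by rewrite mcoeffD freemod_scaleE scalerDl scalerA.
Qed.

HB.instance Definition _ (P : lmodType k) (f : X -> P) :=
  GRing.isLinear.Build k freemod P _ (freelift f) (freelift_is_linear f).

Lemma freelift_gen (P : lmodType k) (f : X -> P) x : freelift f (freegen x) = f x.
Proof.
by rewrite (freeliftEw f msuppU_le) big_seq_fset1 mcoeffUU scale1r.
Qed.

Lemma freemod_gen_sum (g : freemod) : g = \sum_(x <- msupp g) g@_x *: freegen x.
Proof.
apply/malgP => y; rewrite raddf_sum /=.
have E x : ((g@_x *: freegen x : freemod)@_y) = g@_x *+ (x == y).
  by rewrite freemod_scaleE mcoeffU mulr_natr.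
rewrite (eq_bigr _ (fun x _ => E x)).
have [yg|yNg] := boolP (y \in msupp g).
  rewrite (big_fsetD1 y) //= eqxx mulr1n big1_fset ?addr0 // => x.
  by rewrite !inE => /andP[/negPf ->].
rewrite mcoeff_outdom // big1_fset // => x xg _.
by case: eqP xg yNg => // -> ->.
Qed.

End FreeModule.

Section Tensor.
Variables (k : comPzRingType) (M N : lmodType k).

Local Notation gen := (@freegen k (M * N)%type).

Inductive bilinear_rel : freemod k (M * N)%type -> Prop :=
| bilinear_rel_addl m m' n :
    bilinear_rel (gen (m + m', n) - gen (m, n) - gen (m', n))
| bilinear_rel_addr m n n' :
    bilinear_rel (gen (m, n + n') - gen (m, n) - gen (m, n'))
| bilinear_rel_scalel c m n :
    bilinear_rel (gen (c *: m, n) - c *: gen (m, n))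
| bilinear_rel_scaler c m n :
    bilinear_rel (gen (m, c *: n) - c *: gen (m, n)).

Definition tensor : Type := quotmod bilinear_rel.
HB.instance Definition _ := GRing.Lmodule.on tensor.
HB.instance Definition _ := EqQuotient.on tensor.

Definition tens (m : M) (n : N) : tensor := quotmk bilinear_rel (gen (m, n)).

(* Sum of [f m n] over a chosen decomposition of [t] into simple tensors
   [m ⊗ n].  It is meant for bilinear [f] only: then it does not depend on the
   decomposition and is the linear extension of [f], by [tlift_is_linear] and
   [tliftE]. *)
Definition tlift (P : lmodType k) (f : M -> N -> P) (t : tensor) : P :=
  freelift (fun x => f x.1 x.2) (repr t).

Lemma tens_bilinear : bilinear_map tens.
Proof.
have D x y z : bilinear_rel (x - y - z) ->
    quotmk bilinear_rel x = quotmk bilinear_rel y + quotmk bilinear_rel z.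
  by move=> r; rewrite -quotmkD; apply/quotmkP; rewrite opprD addrA; apply: mem_submod_gen.
have Z c x y : bilinear_rel (x - c *: y) ->
    quotmk bilinear_rel x = c *: quotmk bilinear_rel y.
  by move=> r; rewrite -linearZ; apply/quotmkP; apply: mem_submod_gen.
split=> [n c m m'|m c n n']; rewrite /tens.
  by rewrite (D _ _ _ (bilinear_rel_addl _ _ _)) (Z _ _ _ (bilinear_rel_scalel _ _ _)).
by rewrite (D _ _ _ (bilinear_rel_addr _ _ _)) (Z _ _ _ (bilinear_rel_scaler _ _ _)).
Qed.

Section Lift.
Variables (P : lmodType k) (f : M -> N -> P).
Hypothesis f_bilinear : bilinear_map f.

Local Notation F := (freelift (fun x : M * N => f x.1 x.2)).

Lemma tlift_mk g : tlift f (quotmk bilinear_rel g) = F g.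
Proof.
have [fl fr] := f_bilinear.
suff F0 x : submod_gen bilinear_rel x -> F x = 0.
  apply/eqP; rewrite -subr_eq0 -linearB; apply/eqP/F0/quotmkP.
  exact: quotmk_repr.
elim=> [|c {}x y Sx _ IH]; first exact: linear0.
rewrite linearP /= IH addr0.
suff -> : F x = 0 by rewrite scaler0.
case: Sx => [m m' n|m n n'|d m n|d m n];
  rewrite ?linearB ?linearZ /= !freelift_gen /=.
- by have := fl n 1 m m'; rewrite /= !scale1r => ->; rewrite addrAC addrK subrr.
- by have := fr m 1 n n'; rewrite /= !scale1r => ->; rewrite addrAC addrK subrr.
- have f0 : f 0 n = 0.
    by have := fl n (-1) 0 0; rewrite /= !scaleN1r oppr0 addr0 addNr.
  by have := fl n d m 0; rewrite /= f0 !addr0 => ->; rewrite scalerN subrr.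
have f0 : f m 0 = 0.
  by have := fr m (-1) 0 0; rewrite /= !scaleN1r oppr0 addr0 addNr.
by have := fr m d n 0; rewrite /= f0 !addr0 => ->; rewrite scalerN subrr.
Qed.

Lemma tliftE m n : tlift f (tens m n) = f m n.
Proof. by rewrite tlift_mk freelift_gen. Qed.

Lemma tlift_is_linear : linear (tlift f).
Proof.
move=> c x y; rewrite -[x]quotmk_repr -[y]quotmk_repr -linearP !tlift_mk.
exact: linearP.
Qed.

End Lift.

Lemma tensor_ext (P : lmodType k) (u v : tensor -> P) : linear u -> linear v ->
  (forall m n, u (tens m n) = v (tens m n)) -> u =1 v.
Proof.
move=> ul vl uv t; pose w t := u t - v t.
have wl : linear w.
  by move=> c x y; rewrite /w ul vl scalerBr opprD addrACA.
have wq c x y : w (quotmk _ (c *: x + y)) = c *: w (quotmk _ x) + w (quotmk _ y).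
  by rewrite linearP /= wl.
have w0 : w (quotmk _ 0) = 0.
  by have := wq (-1) 0 0; rewrite !scaleN1r oppr0 addr0 addNr.
apply/eqP; rewrite -subr_eq0 -/(w t) -[t]quotmk_repr [repr t]freemod_gen_sum.
apply/eqP; elim/big_rec: _ => // -[m n] x _ IH.
by rewrite wq IH addr0 -/(tens m n) /w uv subrr scaler0.
Qed.

End Tensor.

Notation "m ⊗ n" := (tens m n) : ring_scope.
Notation "\tsum_ ( x , y '<-' t ) F" := (tlift (fun x y => F) t) : ring_scope.

(* [tprod2 f g (a ⊗ b) (m ⊗ n) = f a m ⊗ g b n], for [f], [g] bilinear. *)
Definition tprod2 (k : comPzRingType) (A B M N P Q : lmodType k)
    (f : A -> M -> P) (g : B -> N -> Q) (s : tensor A B) (t : tensor M N) :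
    tensor P Q :=
  \tsum_(a, b <- s) \tsum_(m, n <- t) (f a m ⊗ g b n).

(* [(M, twf)] is an object of the Hom-category over [k]-modules. *)
Record twist (k : comPzRingType) (M : lmodType k) := Twist {
  twf :> {linear M -> M};
  twi : {linear M -> M};
  twfK : cancel twf twi;
  twiK : cancel twi twf
}.

Section HomHopf.
Variables (k : comPzRingType) (A : lmodType k) (t : twist A).
Local Notation α := t.
Local Notation αV := (twi t).

Record is_hom_algebra (mul : A -> A -> A) (one : A) : Prop := {
  hom_mul_bilinear : bilinear_map mul;
  hom_mul_twist a b : α (mul a b) = mul (α a) (α b);
  hom_one_twist : α one = one;
  hom_mulA a b c : mul (α a) (mul b c) = mul (mul a b) (α c);
  hom_mul1 a : mul a one = α a;
  hom_1mul a : mul one a = α a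
}.

Record is_hom_coalgebra (comul : {linear A -> tensor A A})
    (counit : {linear A -> k^o}) : Prop := {
  hom_comul_twist c : comul (α c) = \tsum_(x, y <- comul c) (α x ⊗ α y);
  hom_counit_twist c : counit (α c) = counit c;
  hom_comulA c :
    \tsum_(x, y <- comul c) (αV x ⊗ comul y)
    = \tsum_(x, y <- comul c) \tsum_(x1, x2 <- comul x) (x1 ⊗ (x2 ⊗ αV y));
  hom_comul1 c : \tsum_(x, y <- comul c) (counit y *: x) = αV c;
  hom_1comul c : \tsum_(x, y <- comul c) (counit x *: y) = αV c
}.

Record is_hom_hopf (mul : A -> A -> A) (one : A)
    (comul : {linear A -> tensor A A}) (counit : {linear A -> k^o})
    (antipode : {linear A -> A}) : Prop := {
  hopf_algebra : is_hom_algebra mul one;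
  hopf_coalgebra : is_hom_coalgebra comul counit;
  hopf_comul_mul a b : comul (mul a b) = tprod2 mul mul (comul a) (comul b);
  hopf_comul_one : comul one = one ⊗ one;
  hopf_counit_mul a b : counit (mul a b) = counit a * counit b;
  hopf_counit_one : counit one = 1;
  hopf_antipode_twist a : antipode (α a) = α (antipode a);
  hopf_antipodel a : \tsum_(x, y <- comul a) mul (antipode x) y = counit a *: one;
  hopf_antipoder a : \tsum_(x, y <- comul a) mul x (antipode y) = counit a *: one
}.

End HomHopf.

Record hom_hopf (k : comPzRingType) := HomHopf {
  hcar :> lmodType k;
  htw : twist hcar;
  hmul : hcar -> hcar -> hcar;
  hone : hcar;
  hcomul : {linear hcar -> tensor hcar hcar};
  hcounit : {linear hcar -> k^o};
  hantipode : {linear hcar -> hcar};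
  hom_hopfP : is_hom_hopf htw hmul hone hcomul hcounit hantipode
}.

Section Covariant.
Variables (k : comPzRingType) (H : hom_hopf k).
Local Notation α := (htw H).
Local Notation αV := (twi (htw H)).
Local Notation mul := (@hmul k H).
Local Notation one := (hone H).
Local Notation Δ := (@hcomul k H).
Local Notation ε := (@hcounit k H).

Record is_hom_bimodule (M : lmodType k) (μ : twist M)
    (actl : H -> M -> M) (actr : M -> H -> M) : Prop := {
  actl_bilinear : bilinear_map actl;
  actr_bilinear : bilinear_map actr;
  actl_twist h m : μ (actl h m) = actl (α h) (μ m);
  actr_twist m h : μ (actr m h) = actr (μ m) (α h);
  actlA g h m : actl (α g) (actl h m) = actl (mul g h) (μ m);
  act1l m : actl one m = μ m;
  actrA m g h : actr (actr m g) (α h) = actr (μ m) (mul g h);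
  actr1 m : actr m one = μ m;
  actlr g m h : actr (actl g m) (α h) = actl (α g) (actr m h)
}.

Record is_right_hom_comodule (M : lmodType k) (μ : twist M)
    (σ : {linear M -> tensor M H}) : Prop := {
  coact_twist m : σ (μ m) = \tsum_(x, y <- σ m) (μ x ⊗ α y);
  coactA m :
    \tsum_(x, y <- σ m) (twi μ x ⊗ Δ y)
    = \tsum_(x, y <- σ m) \tsum_(x0, x1 <- σ x) (x0 ⊗ (x1 ⊗ αV y));
  coact1 m : \tsum_(x, y <- σ m) (ε y *: x) = twi μ m
}.

Definition right_covariant (M : lmodType k)
    (actl : H -> M -> M) (actr : M -> H -> M)
    (σ : {linear M -> tensor M H}) : Prop :=
  forall h m g, σ (actr (actl h m) (α g))
    = tprod2 actl mul (Δ (α h)) (tprod2 actr mul (σ m) (Δ g)).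

Record rcb_struct (M : lmodType k) := RcbStruct {
  rtw : twist M;
  ractl : H -> M -> M;
  ractr : M -> H -> M;
  rcoact : {linear M -> tensor M H};
  rcb_bimodule : is_hom_bimodule rtw ractl ractr;
  rcb_comodule : is_right_hom_comodule rtw rcoact;
  rcb_covariant : right_covariant ractl ractr rcoact
}.

Record rcb := Rcb {
  rcar :> lmodType k;
  rstr : rcb_struct rcar
}.

Definition rμ (M : rcb) : twist M := rtw (rstr M).
Definition actl (M : rcb) : H -> M -> M := ractl (rstr M).
Definition actr (M : rcb) : M -> H -> M := ractr (rstr M).
Definition coact (M : rcb) : {linear M -> tensor M H} := rcoact (rstr M).

Record is_rcb_hom (M N : rcb) (f : {linear M -> N}) : Prop := {
  hom_twist m : rμ N (f m) = f (rμ M m);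
  hom_actl h m : f (actl h m) = actl h (f m);
  hom_actr m h : f (actr m h) = actr (f m) h;
  hom_coact m : coact N (f m) = \tsum_(x, y <- coact M m) (f x ⊗ y)
}.

Record rcb_hom (M N : rcb) := RcbHom {
  rhom :> {linear M -> N};
  rhomP : is_rcb_hom rhom
}.

Lemma hopf_is_bimodule : is_hom_bimodule α mul mul.
Proof.
have [[bil tw tw1 A m1 m1'] _ _ _ _ _ _ _ _] := hom_hopfP H.
by split=> // *; rewrite ?A.
Qed.

Lemma hopf_is_comodule : is_right_hom_comodule α Δ.
Proof. by have [_ [? ? ? ? ?] _ _ _ _ _ _ _] := hom_hopfP H; split. Qed.

Lemma hopf_is_covariant : right_covariant mul mul Δ.
Proof.
have [[_ _ _ A _ _] _ D _ _ _ _ _ _] := hom_hopfP H.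
by move=> h m g; rewrite -A !D.
Qed.

Definition hopf_rcb : rcb :=
  Rcb (RcbStruct hopf_is_bimodule hopf_is_comodule hopf_is_covariant).

Section TensorOverH.
Variables M N : rcb.

Definition balanced_rel (x : tensor M N) : Prop :=
  exists m h n, x = actr m h ⊗ n - rμ M m ⊗ actl h (twi (rμ N) n).

Definition htensor : Type := quotmod balanced_rel.
HB.instance Definition _ := GRing.Lmodule.on htensor.
HB.instance Definition _ := EqQuotient.on htensor.

Definition htens (m : M) (n : N) : htensor := quotmk balanced_rel (m ⊗ n).

End TensorOverH.

Lemma tlift_id (U V : lmodType k) (t : tensor U V) : \tsum_(x, y <- t) (x ⊗ y) = t.
Proof.
apply: (@tensor_ext _ _ _ _ _ id); first exact: tlift_is_linear (tens_bilinear _ _).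
  by move=> c x y.
by move=> m n; rewrite tliftE //; apply: tens_bilinear.
Qed.

Lemma id_is_rcb_hom (M : rcb) : is_rcb_hom (idfun : {linear M -> M}).
Proof. by split=> // m; rewrite [RHS]tlift_id. Qed.

Lemma comp_is_rcb_hom (M N P : rcb) (g : rcb_hom N P) (f : rcb_hom M N) :
  is_rcb_hom ((g : {linear N -> P}) \o (f : {linear M -> N})).
Proof.
have [gt gl gr gc] := rhomP g; have [ft fl fr fc] := rhomP f.
split=> [m|h m|m h|m] /=; rewrite ?gt ?ft ?fl ?gl ?fr ?gr ?gc ?fc //.
have bil (U V : lmodType k) (u : {linear U -> V}) :
    bilinear_map (fun (x : U) (y : H) => u x ⊗ y).
  have [tl tr] := tens_bilinear V H.
  by split=> [y c x x'|x c y y']; rewrite ?linearP ?tl ?tr.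
have lin (U V : lmodType k) (u : {linear U -> V}) := tlift_is_linear (bil U V u).
apply: (tensor_ext (u := fun t => tlift _ (tlift _ t)) _ (lin _ _ (g \o f))).
  by move=> c x y; rewrite !lin.
by move=> m' h; rewrite (tliftE (bil _ _ f)) (tliftE (bil _ _ g)) (tliftE (bil _ _ (g \o f))).
Qed.

Lemma rcb_hom_ext (M N : rcb) (f g : rcb_hom M N) : f =1 g -> f = g.
Proof.
case: f g => [f fP] [g gP] /= fg.
have E : f = g.
  case: f g fg {fP gP} => [f [[f1] [f2]]] [g [[g1] [g2]]] /= /funext fg.
  by case: _ / fg in g1 g2 *; rewrite (Prop_irrelevance f1 g1) (Prop_irrelevance f2 g2).
by case: _ / E in gP *; rewrite (Prop_irrelevance fP gP).
Qed.

End Covariant.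

Notation "m ⊗[ M , N ] n" := (@htens _ _ M N m n) : ring_scope.

Record category := Category {
  ob :> Type;
  chom : ob -> ob -> Type;
  cid : forall X, chom X X;
  ccomp : forall X Y Z, chom Y Z -> chom X Y -> chom X Z;
  ccompA : forall X Y Z W (h : chom Z W) (g : chom Y Z) (f : chom X Y),
    ccomp h (ccomp g f) = ccomp (ccomp h g) f;
  ccomp1f : forall X Y (f : chom X Y), ccomp (cid Y) f = f;
  ccompf1 : forall X Y (f : chom X Y), ccomp f (cid X) = f
}.

Notation "g ∘ f" := (ccomp g f) (at level 40, left associativity).

Definition is_iso (C : category) (X Y : C) (f : chom X Y) : Prop :=
  exists g : chom Y X, g ∘ f = cid X /\ f ∘ g = cid Y.

Record is_tensor_category (C : category) (I : C) (tob : C -> C -> C)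
    (tmor : forall X X' Y Y' : C,
       chom X X' -> chom Y Y' -> chom (tob X Y) (tob X' Y'))
    (a : forall X Y Z : C, chom (tob (tob X Y) Z) (tob X (tob Y Z)))
    (l : forall X : C, chom (tob I X) X)
    (r : forall X : C, chom (tob X I) X) : Prop := {
  tensor_id X Y : tmor _ _ _ _ (cid X) (cid Y) = cid (tob X Y);
  tensor_comp X X' X'' Y Y' Y'' (f : chom X X') (f' : chom X' X'')
      (g : chom Y Y') (g' : chom Y' Y'') :
    tmor _ _ _ _ (f' ∘ f) (g' ∘ g) = tmor _ _ _ _ f' g' ∘ tmor _ _ _ _ f g;
  assoc_iso X Y Z : is_iso (a X Y Z);
  assoc_natural X X' Y Y' Z Z' (f : chom X X') (g : chom Y Y') (h : chom Z Z') :
    a X' Y' Z' ∘ tmor _ _ _ _ (tmor _ _ _ _ f g) h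
    = tmor _ _ _ _ f (tmor _ _ _ _ g h) ∘ a X Y Z;
  lunit_iso X : is_iso (l X);
  lunit_natural X Y (f : chom X Y) : l Y ∘ tmor _ _ _ _ (cid I) f = f ∘ l X;
  runit_iso X : is_iso (r X);
  runit_natural X Y (f : chom X Y) : r Y ∘ tmor _ _ _ _ f (cid I) = f ∘ r X;
  pentagon X Y Z W :
    tmor _ _ _ _ (cid X) (a Y Z W) ∘ a X (tob Y Z) W
      ∘ tmor _ _ _ _ (a X Y Z) (cid W)
    = a X Y (tob Z W) ∘ a (tob X Y) Z W;
  triangle X Y :
    tmor _ _ _ _ (cid X) (l Y) ∘ a X I Y = tmor _ _ _ _ (r X) (cid Y)
}.

Arguments is_tensor_category : clear implicits.

Section RcbCategory.
Variables (k : comPzRingType) (H : hom_hopf k).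

Definition rcb_id (M : rcb H) : rcb_hom M M := RcbHom (id_is_rcb_hom M).
Definition rcb_comp (M N P : rcb H) (g : rcb_hom N P) (f : rcb_hom M N) :
  rcb_hom M P := RcbHom (comp_is_rcb_hom g f).

Fact rcb_compA M N P Q (h : rcb_hom P Q) (g : rcb_hom N P) (f : rcb_hom M N) :
  rcb_comp h (rcb_comp g f) = rcb_comp (rcb_comp h g) f.
Proof. exact: rcb_hom_ext. Qed.
Fact rcb_comp1f M N (f : rcb_hom M N) : rcb_comp (rcb_id N) f = f.
Proof. exact: rcb_hom_ext. Qed.
Fact rcb_compf1 M N (f : rcb_hom M N) : rcb_comp f (rcb_id M) = f.
Proof. exact: rcb_hom_ext. Qed.

Definition rcb_category : category :=
  Category rcb_compA rcb_comp1f rcb_compf1.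

End RcbCategory.

(* Main.v *)
(* Every identity to prove is an equality of multilinear maps in the elements
   and in their Sweedler tensors [σ m], [Δ h], so that it can be checked after
   replacing each of these by a simple tensor.  Taking [g = 1] or [h = 1] in the
   covariance axiom gives [σ (h m) = Δ h σ m] and [σ (m g) = σ m Δ g]; hence
   [(m, n) ↦ (m0 ⊗ n0) ⊗ m1 n1] is balanced over [H], and the Hom-coassociativity
   of [M ⊗_H N] is the product of those of [M] and [N] because [Δ] is
   multiplicative.  The inverses of the constraints are
   [m ↦ 1 ⊗ μ^-1 m], [m ↦ μ^-1 m ⊗ 1] and
   [m ⊗ (n ⊗ p) ↦ (μ^-1 m ⊗ n) ⊗ π p]. *)

Require Import Defs.
From HB Require Import structures.
From mathcomp Require Import all_boot all_order all_algebra.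
Set Implicit Arguments.
Unset Strict Implicit.
Unset Printing Implicit Defensive.
Import GRing.Theory.
Local Open Scope ring_scope.

(** * Linear and bilinear maps, and equalities checked on simple tensors *)

Section Linearity.
Variable k : comPzRingType.
Implicit Types U V W P Q : lmodType k.

Lemma linear_id_fun U : linear (fun x : U => x). Proof. by []. Qed.

Lemma linear_compose U V W (g : V -> W) (f : U -> V) :
  linear g -> linear f -> linear (fun x => g (f x)).
Proof. by move=> gl fl c x y; rewrite fl gl. Qed.

Lemma linear_bil1 U V W P (b : V -> W -> P) (f : U -> V) w :
  bilinear_map b -> linear f -> linear (fun x => b (f x) w).
Proof. by case=> bl _ fl c x y; rewrite fl bl. Qed.

Lemma linear_bil2 U V W P (b : V -> W -> P) (f : U -> W) v :
  bilinear_map b -> linear f -> linear (fun x => b v (f x)).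
Proof. by case=> _ br fl c x y; rewrite fl br. Qed.

Lemma linear_tlift U V W P (f : V -> W -> P) (g : U -> tensor V W) :
  bilinear_map f -> linear g -> linear (fun x => tlift f (g x)).
Proof. by move=> fb gl c x y; rewrite gl tlift_is_linear. Qed.

(** Commutativity of [k] enters here: it makes multiplication by [c] linear. *)
Lemma linear_add_scale V P (u v : V -> P) c :
  linear u -> linear v -> linear (fun t => c *: u t + v t).
Proof.
move=> ul vl d x y; rewrite ul vl !scalerDr !scalerA mulrC.
by rewrite addrACA.
Qed.

(** For fixed [c], [x], [y] the claim equates two linear functions of [t], so it may be checked on
    simple tensors, where [tlift] computes. *)
Lemma linear_tlift_fun U V W P (F : U -> V -> W -> P) (t : tensor V W) :
  (forall v w, linear (fun x => F x v w)) -> (forall x, bilinear_map (F x)) ->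
  linear (fun x => tlift (F x) t).
Proof.
move=> Fl Fb c x y.
apply: (@tensor_ext _ _ _ _ (fun t => tlift _ t)
          (fun t => c *: tlift _ t + tlift _ t)).
- exact: tlift_is_linear.
- by apply: linear_add_scale; apply: tlift_is_linear.
- by move=> v w; rewrite !tliftE // Fl.
Qed.

Lemma linear_bilP U V W (f : U -> V -> W) :
  (forall v, linear (fun u => f u v)) -> (forall u, linear (fun v => f u v)) ->
  bilinear_map f.
Proof. by []. Qed.

Lemma linear_scalel U V (c : U -> k^o) (v : V) :
  linear c -> linear (fun x => (c x : k) *: v).
Proof. by move=> cl a x y; rewrite cl scalerDl scalerA. Qed.

Lemma linear_scaler U V (c : k) (f : U -> V) :
  linear f -> linear (fun x => c *: f x).
Proof. by move=> fl a x y; rewrite fl scalerDr !scalerA mulrC. Qed.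

End Linearity.


Create HintDb bilinear.
#[export] Hint Extern 0 (bilinear_map (@tens _ _ _)) =>
  exact: tens_bilinear : bilinear.

Ltac bil := solve [assumption | auto with bilinear nocore].

(** Recursion on the shape of the function. The branches go from special to general, since the one
    for a binary operation also matches [tlift], scaling and bundled linear maps. New bilinear
    operations enter through the [bilinear] hints. *)
Ltac lin :=
  lazymatch goal with
  | |- forall _, _ => intro; lin
  | |- bilinear_map _ =>
      first [ bil
            | apply: linear_bilP => ?; cbv beta; lin ]
  | |- GRing.linear_for _ (GRing.Linear.sort _) => exact: linearP
  | |- GRing.linear_for _ (fun x => x) => exact: linear_id_fun
  | |- GRing.linear_for _ (fun x => tlift (@?F x) (@?g x)) =>
      lazymatch F with
      | (fun _ => ?f) => refine (@linear_tlift _ _ _ _ _ f g _ _); cbv beta; lin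
      | _ => lazymatch g with (fun _ => ?t) =>
          refine (@linear_tlift_fun _ _ _ _ _ F t _ _); cbv beta; lin end
      end
  | |- GRing.linear_for _ (fun x => GRing.Linear.sort ?L (@?g x)) =>
      refine (@linear_compose _ _ _ _ (GRing.Linear.sort L) g _ _); cbv beta;
      [exact: linearP | lin]
  | |- GRing.linear_for _ (fun x => @?c x *: @?g x) =>
      lazymatch g with
      | (fun _ => ?v) => refine (@linear_scalel _ _ _ c v _); lin
      | _ => lazymatch c with
             (fun _ => ?c) => refine (@linear_scaler _ _ _ c g _); lin end
      end
  | |- GRing.linear_for _ (fun x => ?b (@?f x) (@?g x)) =>
      lazymatch g with
      | (fun _ => ?w) => refine (@linear_bil1 _ _ _ _ _ b f w _ _); cbv beta; lin
      | _ => lazymatch f with (fun _ => ?v) =>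
          first [ refine (@linear_bil2 _ _ _ _ _ b g v _ _); cbv beta;
                  [bil | lin]
                | refine (@linear_compose _ _ _ _ (b v) g _ _); cbv beta; lin ]
          end
      end
  | |- GRing.linear_for _ (fun x => ?b (@?f x)) =>
      refine (@linear_compose _ _ _ _ b f _ _); cbv beta; lin
  | |- GRing.linear_for _ _ => first [exact: linearP | assumption ]
  end.

(** Reads the goal as an equality of two linear functions of [t] and replaces [t] by a simple
    tensor. Since [t] must be a variable, Sweedler tensors are generalised before each use. *)
Ltac tens_ind t m n :=
  pattern t;
  lazymatch goal with
  | |- (fun x => @?u x = @?v x) _ =>
      refine (@tensor_ext _ _ _ _ u v _ _ _ t); clear t;
      [ lin | lin | intros m n; cbv beta ]
  end.

Section Tprod.
Variables (k : comPzRingType).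
Variables (A B M N P Q : lmodType k) (f : A -> M -> P) (g : B -> N -> Q).
Hypotheses (fb : bilinear_map f) (gb : bilinear_map g).

Lemma tprod2_bilinear : bilinear_map (tprod2 f g).
Proof. by rewrite /tprod2; lin. Qed.

Lemma tprod2E a b m n : tprod2 f g (a ⊗ b) (m ⊗ n) = f a m ⊗ g b n.
Proof. by rewrite /tprod2 !tliftE //; lin. Qed.

End Tprod.
#[export] Hint Extern 0 (bilinear_map (tprod2 _ _)) =>
  apply: tprod2_bilinear; lin : bilinear.

(* [rewrite tliftE] would unfold the arguments in search of a simple tensor;
   these tactics only look at redexes that are syntactically present. *)
Ltac rewrite_at x E :=
  pattern x;
  lazymatch goal with |- ?Q _ => refine (@eq_ind_r _ _ Q _ x E); cbv beta end.

Ltac tE :=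
  repeat match goal with
  | |- context [@tlift ?k ?M ?N ?P ?f ?s] =>
      lazymatch s with tens ?m ?n =>
        let b := fresh in
        assert (b : bilinear_map f) by lin;
        rewrite_at (@tlift k M N P f s) (@tliftE k M N P f b m n); clear b
      end
  | |- context [@tprod2 ?k ?A ?B ?M ?N ?P ?Q ?f ?g ?s ?t] =>
      lazymatch s with tens ?a ?b => lazymatch t with tens ?m ?n =>
        let bf := fresh in
        let bg := fresh in
        assert (bf : bilinear_map f) by lin;
        assert (bg : bilinear_map g) by lin;
        rewrite_at (@tprod2 k A B M N P Q f g s t)
          (@tprod2E k A B M N P Q f g bf bg a b m n);
        clear bf bg
      end end
  end.

Section LinearPack.
Variables (k : comPzRingType) (U V : lmodType k) (f : U -> V).
Hypothesis fl : linear f.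
HB.instance Definition _ := GRing.isLinear.Build k U V _ f fl.
Definition mklin : {linear U -> V} := f.
Lemma mklinE x : mklin x = f x. Proof. by []. Qed.
End LinearPack.

Lemma linear_scale (k : comPzRingType) (U V : lmodType k) (f : U -> V) c x :
  linear f -> f (c *: x) = c *: f x.
Proof. by move=> fl; rewrite -[f _]/(mklin fl _) linearZ. Qed.

(** * The universal property of the tensor product over [H] *)

Section TensorOverHTheory.
Variables (k : comPzRingType) (H : hom_hopf k) (M N : rcb H).
Implicit Types P U : lmodType k.

Definition balanced P (f : M -> N -> P) : Prop :=
  forall m h n, f (actr m h) n = f (rμ M m) (actl h (twi (rμ N) n)).

Lemma htens_bilinear : bilinear_map (@htens k H M N).
Proof.
have [tl tr] := tens_bilinear M N.
by split=> x c y z; rewrite /htens ?tl ?tr linearP.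
Qed.

Lemma htens_balanced : balanced (@htens k H M N).
Proof.
move=> m h n; apply/quotmkP; apply: mem_submod_gen.
by exists m, h, n.
Qed.

(** Evaluation at a chosen representative: meaningful for balanced bilinear [f], by [hlift_mk]. *)
Definition hlift P (f : M -> N -> P) (t : htensor M N) : P :=
  tlift f (generic_quotient.repr t).

Section Lift.
Variables (P : lmodType k) (f : M -> N -> P).
Hypotheses (fb : bilinear_map f) (fH : balanced f).

(** By [fH] the linear extension of [f] kills the balancing relations, hence the submodule they
    generate, so the choice of representative does not matter. *)
Lemma hlift_mk t : hlift f (quotmk (@balanced_rel k H M N) t) = tlift f t.
Proof.
pose F := mklin (tlift_is_linear fb).
suff F0 x : submod_gen (@balanced_rel k H M N) x -> F x = 0.
  apply/eqP; rewrite -subr_eq0 -[X in X - _]/(F _) -[X in _ - X]/(F t).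
  by rewrite -linearB; apply/eqP/F0/quotmkP/quotmk_repr.
elim=> [|c {}x y [m [h [n ->]]] _ IH]; first exact: linear0.
by rewrite linearP IH addr0 linearB /F !mklinE !tliftE // fH subrr scaler0.
Qed.

Lemma hliftE m n : hlift f (m ⊗[M, N] n) = f m n.
Proof. by rewrite hlift_mk tliftE. Qed.

Lemma hlift_linear : linear (hlift f).
Proof.
move=> c x y; rewrite -[x]quotmk_repr -[y]quotmk_repr -linearP !hlift_mk.
exact: tlift_is_linear.
Qed.

End Lift.

Lemma htensor_ext P (u v : htensor M N -> P) : linear u -> linear v ->
  (forall m n, u (m ⊗[M, N] n) = v (m ⊗[M, N] n)) -> u =1 v.
Proof.
move=> ul vl uv t; rewrite -[t]quotmk_repr.
apply: (@tensor_ext _ _ _ _ (fun t => u (quotmk _ t)) (fun t => v (quotmk _ t))).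
- by move=> c x y; rewrite linearP ul.
- by move=> c x y; rewrite linearP vl.
- exact: uv.
Qed.

(** Serves for maps with a third variable carried as a parameter: the two actions on a tensor
    product, the associator and its inverse. *)
Lemma hlift_bilinear U P (F : U -> M -> N -> P) :
  (forall m n, linear (fun u => F u m n)) -> (forall u, bilinear_map (F u)) ->
  (forall u, balanced (F u)) -> bilinear_map (fun u => hlift (F u)).
Proof.
move=> Fl Fb FH; split=> [t c u u'|u]; last exact: hlift_linear.
apply: (@htensor_ext _ (hlift _) (fun t => c *: hlift _ t + hlift _ t)).
- exact: hlift_linear.
- by apply: linear_add_scale; apply: hlift_linear.
- by move=> m n; rewrite !hliftE // Fl.
Qed.

End TensorOverHTheory.
#[export] Hint Extern 0 (bilinear_map (@htens _ _ _ _)) =>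
  exact: htens_bilinear : bilinear.

Ltac ht_ind t M N m n :=
  pattern t;
  lazymatch goal with
  | |- (fun x => @?u x = @?v x) _ =>
      refine (@htensor_ext _ _ M N _ u v _ _ _ t); clear t;
      [ lin | lin | intros m n; cbv beta ]
  end.

(** * The axioms of [H] and of its right-covariant bimodules in rewriting form *)

Section ActionsBilinear.
Variables (k : comPzRingType) (H : hom_hopf k).

Lemma hmul_bilinear : bilinear_map (@hmul k H).
Proof. by case: (hopf_algebra (hom_hopfP H)). Qed.
Lemma actl_is_bilinear (M : rcb H) : bilinear_map (@actl k H M).
Proof. by case: (rcb_bimodule (rstr M)). Qed.
Lemma actr_is_bilinear (M : rcb H) : bilinear_map (@actr k H M).
Proof. by case: (rcb_bimodule (rstr M)). Qed.

End ActionsBilinear.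
#[export] Hint Extern 0 (bilinear_map (@hmul _ _)) =>
  exact: hmul_bilinear : bilinear.
#[export] Hint Extern 0 (bilinear_map (@actl _ _ _)) =>
  exact: actl_is_bilinear : bilinear.
#[export] Hint Extern 0 (bilinear_map (@actr _ _ _)) =>
  exact: actr_is_bilinear : bilinear.

Section Covariant.
Variables (k : comPzRingType) (H : hom_hopf k).
Local Notation α := (htw H).
Local Notation αV := (twi (htw H)).
Local Notation mul := (@hmul k H).
Local Notation one := (hone H).
Local Notation Δ := (@hcomul k H).
Local Notation ε := (@hcounit k H).

Lemma hmulA a b c : mul (α a) (mul b c) = mul (mul a b) (α c).
Proof. exact: (hom_mulA (hopf_algebra (hom_hopfP H))). Qed.
Lemma hmul_tw a b : α (mul a b) = mul (α a) (α b).
Proof. exact: (hom_mul_twist (hopf_algebra (hom_hopfP H))). Qed.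
Lemma hone_tw : α one = one.
Proof. exact: (hom_one_twist (hopf_algebra (hom_hopfP H))). Qed.
Lemma hmulr1 a : mul a one = α a.
Proof. exact: (hom_mul1 (hopf_algebra (hom_hopfP H))). Qed.
Lemma hmul1r a : mul one a = α a.
Proof. exact: (hom_1mul (hopf_algebra (hom_hopfP H))). Qed.
Lemma hmul_twi a b : αV (mul a b) = mul (αV a) (αV b).
Proof. by apply: (can_inj (twfK α)); rewrite hmul_tw !twiK. Qed.
Lemma hone_twi : αV one = one.
Proof. by rewrite -{1}hone_tw twfK. Qed.

Section Bimodule.
Variable M : rcb H.
Local Notation μ := (rμ M).
Local Notation μV := (twi (rμ M)).
Let B : is_hom_bimodule μ (@actl k H M) (@actr k H M) := rcb_bimodule (rstr M).

Lemma ractl_tw h (m : M) : μ (actl h m) = actl (α h) (μ m).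
Proof. exact: (actl_twist B). Qed.
Lemma ractr_tw h (m : M) : μ (actr m h) = actr (μ m) (α h).
Proof. exact: (actr_twist B). Qed.
Lemma ractl_twi h (m : M) : μV (actl h m) = actl (αV h) (μV m).
Proof. by apply: (can_inj (twfK μ)); rewrite ractl_tw !twiK. Qed.
Lemma ractr_twi h (m : M) : μV (actr m h) = actr (μV m) (αV h).
Proof. by apply: (can_inj (twfK μ)); rewrite ractr_tw !twiK. Qed.
Lemma ractlA g h (m : M) : actl (α g) (actl h m) = actl (mul g h) (μ m).
Proof. exact: (actlA B). Qed.
Lemma ract1l (m : M) : actl one m = μ m.
Proof. exact: (act1l B). Qed.
Lemma ractrA (m : M) g h : actr (actr m g) (α h) = actr (μ m) (mul g h).
Proof. exact: (actrA B). Qed.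
Lemma ractr1 (m : M) : actr m one = μ m.
Proof. exact: (actr1 B). Qed.
Lemma ractlr g (m : M) h : actr (actl g m) (α h) = actl (α g) (actr m h).
Proof. exact: (actlr B). Qed.
End Bimodule.

Section Comodule.
Variable M : rcb H.
Local Notation μ := (rμ M).
Local Notation μV := (twi (rμ M)).
Local Notation σ := (coact M).
Let C : is_right_hom_comodule μ σ := rcb_comodule (rstr M).

Lemma rcoact_tw m : σ (μ m) = \tsum_(x, y <- σ m) (μ x ⊗ α y).
Proof. exact: (coact_twist C). Qed.
Lemma rcoact_twi m : σ (μV m) = \tsum_(x, y <- σ m) (μV x ⊗ αV y).
Proof.
rewrite -{2}[m](twiK μ) rcoact_tw; move: (σ _) => t.
tens_ind t x y; tE; by rewrite !twfK.
Qed.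

Lemma rcoactA m :
  \tsum_(x, y <- σ m) (μV x ⊗ Δ y)
  = \tsum_(x, y <- σ m) \tsum_(x0, x1 <- σ x) (x0 ⊗ (x1 ⊗ αV y)).
Proof. exact: (coactA C). Qed.
Lemma rcoact1 m : \tsum_(x, y <- σ m) (ε y *: x) = μV m.
Proof. exact: (coact1 C). Qed.

Lemma hcomul_tw c : Δ (α c) = \tsum_(x, y <- Δ c) (α x ⊗ α y).
Proof. exact: (hom_comul_twist (hopf_coalgebra (hom_hopfP H))). Qed.
Lemma hcomul_twi c : Δ (αV c) = \tsum_(x, y <- Δ c) (αV x ⊗ αV y).
Proof.
rewrite -{2}[c](twiK α) hcomul_tw; move: (Δ _) => t.
tens_ind t x y; tE; by rewrite !twfK.
Qed.
Lemma hcomul_one : Δ one = one ⊗ one.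
Proof. exact: (hopf_comul_one (hom_hopfP H)). Qed.
Lemma hcomul_mul a b : Δ (mul a b) = tprod2 mul mul (Δ a) (Δ b).
Proof. exact: (hopf_comul_mul (hom_hopfP H)). Qed.
Lemma hcounit_mul a b : ε (mul a b) = ε a * ε b.
Proof. exact: (hopf_counit_mul (hom_hopfP H)). Qed.

Lemma rcovariant h (m : M) g : σ (actr (actl h m) (α g))
  = tprod2 (@actl k H M) mul (Δ (α h)) (tprod2 (@actr k H M) mul (σ m) (Δ g)).
Proof. exact: (rcb_covariant (rstr M)). Qed.

Lemma rcoact_actl h (m : M) :
  σ (actl h m) = tprod2 (@actl k H M) mul (Δ h) (σ m).
Proof.
(* On the right [one] acts as [μ], which turns [αV h] acting on [μV m] into [h] acting on [m]. *)
have := rcovariant (αV h) (μV m) one.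
rewrite hone_tw ractr1 ractl_tw !twiK => ->.
rewrite rcoact_twi hcomul_one; congr (tprod2 _ _ _ _).
move: (σ m) => t; tens_ind t x y; tE.
by rewrite ractr1 hmulr1 !twiK.
Qed.

Lemma rcoact_actr (m : M) g :
  σ (actr m g) = tprod2 (@actr k H M) mul (σ m) (Δ g).
Proof.
(* On the left [one] acts as [μ], which cancels [μV], while [αV g] absorbs the [α] in the axiom. *)
have := rcovariant one (μV m) (αV g).
rewrite hone_tw ract1l !twiK => ->.
rewrite rcoact_twi hcomul_twi hcomul_one.
move: (σ m) (Δ g) => t s; tens_ind t x y; tens_ind s a b; tE.
by rewrite ract1l hmul1r ractr_tw hmul_tw !twiK.
Qed.

End Comodule.

(** * Balanced maps underlying the structure on the tensor product *)

Section TensorProduct.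
Variables M N : rcb H.
Local Notation μ := (rμ M).
Local Notation ν := (rμ N).
Local Notation μV := (twi (rμ M)).
Local Notation νV := (twi (rμ N)).
Local Notation MN := (htensor M N).

Lemma htens_swap (m : M) h (n : N) :
  actr m h ⊗[M, N] n = μ m ⊗[M, N] actl h (νV n).
Proof. exact: htens_balanced. Qed.

Definition ht_twf_fun (m : M) (n : N) := μ m ⊗[M, N] ν n.
Definition ht_twi_fun (m : M) (n : N) := μV m ⊗[M, N] νV n.
Definition ht_actl_fun h (m : M) (n : N) := actl (αV h) m ⊗[M, N] ν n.
Definition ht_actr_fun h (m : M) (n : N) := μ m ⊗[M, N] actr n (αV h).
Definition ht_coact_fun (m : M) (n : N) : tensor MN H :=
  tprod2 (@htens k H M N) mul (coact M m) (coact N n).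

Lemma ht_twf_bilinear : bilinear_map ht_twf_fun.
Proof. by rewrite /ht_twf_fun; lin. Qed.
Lemma ht_twi_bilinear : bilinear_map ht_twi_fun.
Proof. by rewrite /ht_twi_fun; lin. Qed.
Lemma ht_actl_bilinear h : bilinear_map (ht_actl_fun h).
Proof. by rewrite /ht_actl_fun; lin. Qed.
Lemma ht_actr_bilinear h : bilinear_map (ht_actr_fun h).
Proof. by rewrite /ht_actr_fun; lin. Qed.
Lemma ht_coact_bilinear : bilinear_map ht_coact_fun.
Proof. by rewrite /ht_coact_fun; lin. Qed.

Lemma ht_twf_balanced : balanced ht_twf_fun.
Proof.
by move=> m h n; rewrite /ht_twf_fun ractr_tw ractl_tw htens_swap twfK twiK.
Qed.
Lemma ht_twi_balanced : balanced ht_twi_fun.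
Proof.
by move=> m h n; rewrite /ht_twi_fun ractr_twi ractl_twi htens_swap twfK twiK.
Qed.
(** The bimodule law [ractlr] brings [g] outside the left action, as [α g]; from there it can cross
    the tensor sign. *)
Lemma ht_actl_balanced h : balanced (ht_actl_fun h).
Proof.
move=> m g n; rewrite /ht_actl_fun ractl_tw twiK.
rewrite -[αV h](twiK α) -ractlr htens_swap twfK ractl_tw.
by rewrite !twiK.
Qed.
Lemma ht_actr_balanced h : balanced (ht_actr_fun h).
Proof.
move=> m g n; rewrite /ht_actr_fun ractr_tw htens_swap.
rewrite -[αV h](twiK α) ractlr ractr_twi.
by rewrite !twfK.
Qed.
(** On Sweedler components, the first factors agree by the balancing relation and the second ones by
    Hom-associativity, [(m1 g2) n1 = α m1 (g2 (αV n1))]. *)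
Lemma ht_coact_balanced : balanced ht_coact_fun.
Proof.
move=> m g n; rewrite /ht_coact_fun rcoact_actr rcoact_actl rcoact_tw rcoact_twi.
move: (coact M m) (coact N n) (Δ g) => s t u.
tens_ind s m0 m1; tens_ind t n0 n1; tens_ind u g1 g2; tE.
by rewrite htens_swap hmulA twiK.
Qed.

End TensorProduct.

End Covariant.

(** * The right-covariant Hom-bimodule structure on the tensor product *)

Section TensorStructure.
Variables (k : comPzRingType) (H : hom_hopf k).
Local Notation αV := (twi (htw H)).
Local Notation mul := (@hmul k H).
Local Notation Δ := (@hcomul k H).
Variables M N : rcb H.
Local Notation μ := (rμ M).
Local Notation ν := (rμ N).
Local Notation μV := (twi (rμ M)).
Local Notation νV := (twi (rμ N)).
Local Notation MN := (htensor M N).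

Let twl := hlift_linear (@ht_twf_bilinear k H M N) (@ht_twf_balanced k H M N).
Let til := hlift_linear (@ht_twi_bilinear k H M N) (@ht_twi_balanced k H M N).
Let col := hlift_linear (@ht_coact_bilinear k H M N) (@ht_coact_balanced k H M N).

Definition ht_actl (h : H) : MN -> MN := hlift (@ht_actl_fun k H M N h).
Definition ht_actr (t : MN) (h : H) : MN := hlift (@ht_actr_fun k H M N h) t.
Definition ht_coact : {linear MN -> tensor MN H} := mklin col.

Lemma mklin_twfE m n : mklin twl (m ⊗[M, N] n) = μ m ⊗[M, N] ν n.
Proof. exact: hliftE (@ht_twf_bilinear k H M N) (@ht_twf_balanced k H M N) m n. Qed.
Lemma mklin_twiE m n : mklin til (m ⊗[M, N] n) = μV m ⊗[M, N] νV n.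
Proof. exact: hliftE (@ht_twi_bilinear k H M N) (@ht_twi_balanced k H M N) m n. Qed.
Lemma ht_coactE m n :
  ht_coact (m ⊗[M, N] n) = tprod2 (@htens k H M N) mul (coact M m) (coact N n).
Proof. exact: hliftE (@ht_coact_bilinear k H M N) (@ht_coact_balanced k H M N) m n. Qed.
Lemma ht_actlE h m n : ht_actl h (m ⊗[M, N] n) = actl (αV h) m ⊗[M, N] ν n.
Proof. exact: hliftE (@ht_actl_bilinear k H M N h) (@ht_actl_balanced k H M N h) _ _. Qed.
Lemma ht_actrE h m n : ht_actr (m ⊗[M, N] n) h = μ m ⊗[M, N] actr n (αV h).
Proof. exact: hliftE (@ht_actr_bilinear k H M N h) (@ht_actr_balanced k H M N h) _ _. Qed.

Lemma ht_twfK : cancel (mklin twl) (mklin til).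
Proof. by move=> t; ht_ind t M N m n; rewrite mklin_twfE mklin_twiE !twfK. Qed.
Lemma ht_twiK : cancel (mklin til) (mklin twl).
Proof. by move=> t; ht_ind t M N m n; rewrite mklin_twiE mklin_twfE !twiK. Qed.

Definition ht_twist : twist MN := Twist ht_twfK ht_twiK.

Lemma ht_twistE m n : ht_twist (m ⊗[M, N] n) = μ m ⊗[M, N] ν n.
Proof. exact: mklin_twfE. Qed.
Lemma ht_twistVE m n : twi ht_twist (m ⊗[M, N] n) = μV m ⊗[M, N] νV n.
Proof. exact: mklin_twiE. Qed.

Lemma ht_actl_bil : bilinear_map ht_actl.
Proof.
apply: hlift_bilinear => [m n|h|h]; last exact: ht_actl_balanced.
  by rewrite /ht_actl_fun; lin.
exact: ht_actl_bilinear.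
Qed.
Lemma ht_actr_bil : bilinear_map ht_actr.
Proof.
(* The arguments are exchanged because [hlift_bilinear] takes the parameter first. *)
suff [l r] : bilinear_map (fun h t => ht_actr t h) by split.
apply: hlift_bilinear => [m n|h|h]; last exact: ht_actr_balanced.
  by rewrite /ht_actr_fun; lin.
exact: ht_actr_bilinear.
Qed.
#[local] Hint Extern 0 (bilinear_map ht_actl) => exact: ht_actl_bil : bilinear.
#[local] Hint Extern 0 (bilinear_map ht_actr) => exact: ht_actr_bil : bilinear.

Lemma ht_is_bimodule : is_hom_bimodule ht_twist ht_actl ht_actr.
Proof.
split.
- exact: ht_actl_bil.
- exact: ht_actr_bil.
- move=> h t; ht_ind t M N m n.
  by rewrite !(ht_twistE, ht_actlE) ractl_tw twiK twfK.
- move=> t h; ht_ind t M N m n.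
  by rewrite !(ht_twistE, ht_actrE) ractr_tw twiK twfK.
- move=> g h t; ht_ind t M N m n.
  by rewrite !(ht_twistE, ht_actlE) hmul_twi -ractlA twiK twfK.
- move=> t; ht_ind t M N m n.
  by rewrite ht_twistE ht_actlE hone_twi ract1l.
- move=> t g h; ht_ind t M N m n.
  by rewrite !(ht_twistE, ht_actrE) hmul_twi -ractrA twiK twfK.
- move=> t; ht_ind t M N m n.
  by rewrite ht_twistE ht_actrE hone_twi ractr1.
- move=> g t h; ht_ind t M N m n.
  by rewrite !(ht_actlE, ht_actrE) ractl_tw ractr_tw !twiK !twfK.
Qed.

Lemma ht_is_comodule : is_right_hom_comodule ht_twist ht_coact.
Proof.
split=> t; ht_ind t M N m n.
- rewrite ht_twistE !ht_coactE !rcoact_tw.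
  move: (coact M m) (coact N n) => s u; tens_ind s m0 m1; tens_ind u n0 n1; tE.
  by rewrite ht_twistE hmul_tw.
- rewrite ht_coactE.
  (* [Φ] multiplies the two coassociativity identities together; the product on [H ⊗ H] in its
     second component matches [Δ (m1 n1)]. *)
  pose Φ := tprod2 (@htens k H M N) (tprod2 mul mul).
  transitivity (Φ (\tsum_(x, y <- coact M m) (μV x ⊗ Δ y))
                  (\tsum_(x, y <- coact N n) (νV x ⊗ Δ y))).
    rewrite /Φ.
    move: (coact M m) (coact N n) => s u; tens_ind s m0 m1; tens_ind u n0 n1; tE.
    by rewrite ht_twistVE hcomul_mul.
  rewrite (rcoactA m) (rcoactA n) /Φ.
  move: (coact M m) (coact N n) => s u; tens_ind s m0 m1; tens_ind u n0 n1; tE.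
  rewrite ht_coactE.
  move: (coact M m0) (coact N n0) => s u; tens_ind s m00 m01; tens_ind u n00 n01; tE.
  by rewrite hmul_twi.
(* Expanding [μV m] and [νV n] by the counit leaves the scalars [ε m1] and [ε n1], whose product is
   [ε (m1 n1)]. *)
- rewrite ht_coactE ht_twistVE -(rcoact1 m) -(rcoact1 n).
  move: (coact M m) (coact N n) => s u; tens_ind s m0 m1; tens_ind u n0 n1; tE.
  have [l r] := htens_bilinear M N.
  have lZ c x y : (c *: x) ⊗[M, N] y = c *: (x ⊗[M, N] y).
    exact: (linear_scale c x (l y)).
  have rZ c x y : x ⊗[M, N] (c *: y) = c *: (x ⊗[M, N] y).
    exact: (linear_scale c y (r x)).
  by rewrite lZ rZ scalerA hcounit_mul.
Qed.

(** The twists [αV h] and [ν n] in the action are exactly those that Hom-associativity needs in the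
    component in [H]: [(αV h1 m1) (α n1) = h1 (m1 n1)]. *)
Lemma ht_coact_actl h t :
  ht_coact (ht_actl h t) = tprod2 ht_actl mul (Δ h) (ht_coact t).
Proof.
ht_ind t M N m n.
rewrite ht_actlE !ht_coactE rcoact_actl rcoact_tw hcomul_twi.
move: (coact M m) (coact N n) (Δ h) => s u v.
tens_ind s m0 m1; tens_ind u n0 n1; tens_ind v h0 h1; tE.
by rewrite ht_actlE -hmulA twiK.
Qed.

Lemma ht_coact_actr h t :
  ht_coact (ht_actr t h) = tprod2 ht_actr mul (ht_coact t) (Δ h).
Proof.
ht_ind t M N m n.
rewrite ht_actrE !ht_coactE rcoact_actr rcoact_tw hcomul_twi.
move: (coact M m) (coact N n) (Δ h) => s u v.
tens_ind s m0 m1; tens_ind u n0 n1; tens_ind v h0 h1; tE.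
by rewrite ht_actrE hmulA twiK.
Qed.

(** The two one-sided formulas combine: the actions are exchanged by [actlr] in the first component,
    and Hom-associativity regroups the second. *)
Lemma ht_is_covariant : right_covariant ht_actl ht_actr ht_coact.
Proof.
move=> h t g.
rewrite ht_coact_actr ht_coact_actl !hcomul_tw.
move: (ht_coact t) (Δ g) (Δ h) => s u v.
tens_ind s m0 m1; tens_ind u n0 n1; tens_ind v h0 h1; tE.
by rewrite (actlr ht_is_bimodule) hmulA.
Qed.

Definition ht_struct : rcb_struct H MN :=
  RcbStruct ht_is_bimodule ht_is_comodule ht_is_covariant.

End TensorStructure.

(** * Constructing morphisms out of a tensor product, and isomorphisms *)

Section Morphisms.
Variables (k : comPzRingType) (H : hom_hopf k).
Local Notation αV := (twi (htw H)).
Local Notation mul := (@hmul k H).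

Definition ht_rcb (M N : rcb H) : rcb H := Rcb (ht_struct M N).

Section Eqns.
Variables M N : rcb H.
Local Notation T := (ht_rcb M N).

Lemma rht_tw (m : M) (n : N) : rμ T (m ⊗[M, N] n) = rμ M m ⊗[M, N] rμ N n.
Proof. exact: ht_twistE. Qed.
Lemma rht_twi (m : M) (n : N) :
  twi (rμ T) (m ⊗[M, N] n) = twi (rμ M) m ⊗[M, N] twi (rμ N) n.
Proof. exact: ht_twistVE. Qed.
Lemma rht_actl h (m : M) (n : N) :
  @actl k H T h (m ⊗[M, N] n) = actl (αV h) m ⊗[M, N] rμ N n.
Proof. exact: ht_actlE. Qed.
Lemma rht_actr h (m : M) (n : N) :
  @actr k H T (m ⊗[M, N] n) h = rμ M m ⊗[M, N] actr n (αV h).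
Proof. exact: ht_actrE. Qed.
Lemma rht_coact (m : M) (n : N) :
  coact T (m ⊗[M, N] n)
  = tprod2 (P := T) (@htens k H M N) mul (coact M m) (coact N n).
Proof. exact: ht_coactE. Qed.

Section HliftHom.
Variables (P : rcb H) (f : M -> N -> P).
Hypotheses (fb : bilinear_map f) (fH : balanced f).
Hypothesis f_tw : forall m n, rμ P (f m n) = f (rμ M m) (rμ N n).
Hypothesis f_actl : forall h m n, f (actl (αV h) m) (rμ N n) = actl h (f m n).
Hypothesis f_actr : forall h m n, f (rμ M m) (actr n (αV h)) = actr (f m n) h.
Hypothesis f_coact : forall m n,
  coact P (f m n) = tprod2 f mul (coact M m) (coact N n).

Let F : {linear T -> P} := mklin (hlift_linear fb fH).

Let FE m n : F (m ⊗[M, N] n) = f m n.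
Proof. exact: hliftE. Qed.

Lemma hlift_is_rcb_hom : is_rcb_hom F.
Proof.
split.
- by move=> t; ht_ind t M N m n; rewrite rht_tw !FE.
- by move=> h t; ht_ind t M N m n; rewrite rht_actl !FE.
- by move=> t h; ht_ind t M N m n; rewrite rht_actr !FE.
- move=> t; ht_ind t M N m n; rewrite rht_coact FE f_coact.
  move: (coact M m) (coact N n) => s u; tens_ind s m0 m1; tens_ind u n0 n1; tE.
  by rewrite FE.
Qed.

(** The common source of tensor products of morphisms and of all three constraints: only conditions
    on simple tensors remain. *)
Lemma hlift_hom : {F : rcb_hom T P | forall m n, F (m ⊗[M, N] n) = f m n}.
Proof. by exists (RcbHom hlift_is_rcb_hom); exact: FE. Qed.
End HliftHom.
End Eqns.

(** A linear inverse of a morphism respects all structure: write [n] as [f (g n)] and use the law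
    for [f]. Inverses of the constraints are thus needed only as linear maps. *)
Lemma rcb_hom_iso (M N : rcb_category H) (f : chom M N) (g : rcar N -> rcar M) :
  linear g -> cancel (rhom f) g -> cancel g (rhom f) -> is_iso f.
Proof.
move=> gl fK gK; have [ft fl fr fc] := rhomP f.
have gP : is_rcb_hom (mklin gl).
  split=> [n|h n|n h|n]; rewrite !mklinE.
  - by rewrite -{2}[n]gK ft fK.
  - by rewrite -{1}[n]gK -fl fK.
  - by rewrite -{1}[n]gK -fr fK.
  - rewrite -{2}[n]gK fc; move: (coact M _) => t.
    tens_ind t x y; tE.
    by rewrite mklinE fK.
by exists (RcbHom gP); split; apply: rcb_hom_ext => x; [apply: fK | apply: gK].
Qed.

End Morphisms.

(** * Tensor products of morphisms and the unit constraints *)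

Section Constraints.
Variables (k : comPzRingType) (H : hom_hopf k).
Local Notation α := (htw H).
Local Notation αV := (twi (htw H)).
Local Notation mul := (@hmul k H).
Local Notation one := (hone H).
Local Notation U := (hopf_rcb H).

(** Needed because the balancing relation and the associator involve inverse twists. *)
Lemma rhom_twi (M N : rcb H) (f : rcb_hom M N) m :
  f (twi (rμ M) m) = twi (rμ N) (f m).
Proof. by apply: (can_inj (twfK (rμ N))); rewrite (hom_twist (rhomP f)) !twiK. Qed.

Section Functor.
Variables (M M' N N' : rcb H) (f : rcb_hom M M') (g : rcb_hom N N').

Definition tmor_fun (m : M) (n : N) : ht_rcb M' N' := f m ⊗[M', N'] g n.

Lemma tmor_bilinear : bilinear_map tmor_fun.
Proof. by rewrite /tmor_fun; lin. Qed.
Lemma tmor_balanced : balanced tmor_fun.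
Proof.
move=> m h n; rewrite /tmor_fun (hom_actr (rhomP f)) (hom_actl (rhomP g)).
by rewrite htens_swap rhom_twi (hom_twist (rhomP f)).
Qed.

(* The structure morphisms are opaque: on nested tensor products, unification
   does not come back from unfolding them. *)
Lemma rcb_tmor_sig : {F : rcb_hom (ht_rcb M N) (ht_rcb M' N') |
  forall m n, F (m ⊗[M, N] n) = f m ⊗[M', N'] g n}.
Proof.
refine (hlift_hom tmor_bilinear tmor_balanced _ _ _ _)
  => [m n|h m n|h m n|m n]; rewrite /tmor_fun.
- by rewrite rht_tw (hom_twist (rhomP f)) (hom_twist (rhomP g)).
- by rewrite rht_actl (hom_actl (rhomP f)) (hom_twist (rhomP g)).
- by rewrite rht_actr (hom_actr (rhomP g)) (hom_twist (rhomP f)).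
- rewrite rht_coact (hom_coact (rhomP f)) (hom_coact (rhomP g)).
  move: (coact M m) (coact N n) => s u; tens_ind s m0 m1; tens_ind u n0 n1; by tE.
Qed.
Definition rcb_tmor := sval rcb_tmor_sig.
Lemma rcb_tmorE m n : rcb_tmor (m ⊗[M, N] n) = f m ⊗[M', N'] g n.
Proof. exact: (svalP rcb_tmor_sig). Qed.

End Functor.

Lemma U_actl h (a : H) : @actl k H U h a = mul h a. Proof. by []. Qed.
Lemma U_actr h (a : H) : @actr k H U a h = mul a h. Proof. by []. Qed.
Lemma U_tw (a : H) : rμ U a = α a. Proof. by []. Qed.

Section Units.
Variable M : rcb H.

(** Over the regular object, balancedness is Hom-associativity of the action. *)
Lemma lunit_balanced : @balanced k H U M M (@actl k H M).
Proof. by move=> m h n; rewrite U_actr U_tw ractlA twiK. Qed.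

Lemma rcb_lunit_sig : {F : rcb_hom (ht_rcb U M) M |
  forall (h : U) (m : M), F (h ⊗[U, M] m) = actl h m}.
Proof.
refine (hlift_hom (M := U) (actl_is_bilinear M) lunit_balanced _ _ _ _)
  => [h m|g h m|g h m|h m].
- exact: ractl_tw.
- by rewrite -[in RHS](twiK α g) ractlA.
- by rewrite -[in RHS](twiK α g) ractlr.
- exact: rcoact_actl.
Qed.
Definition rcb_lunit := sval rcb_lunit_sig.
Lemma rcb_lunitE (h : U) (m : M) : rcb_lunit (h ⊗[U, M] m) = actl h m.
Proof. exact: (svalP rcb_lunit_sig). Qed.

Lemma runit_balanced : @balanced k H M U M (@actr k H M).
Proof. by move=> m h n; rewrite U_actl -[n in LHS](twiK α) ractrA. Qed.

Lemma rcb_runit_sig : {F : rcb_hom (ht_rcb M U) M |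
  forall (m : M) (h : U), F (m ⊗[M, U] h) = actr m h}.
Proof.
refine (hlift_hom (N := U) (actr_is_bilinear M) runit_balanced _ _ _ _)
  => [m h|g m h|g m h|m h].
- exact: ractr_tw.
- by rewrite -[in RHS](twiK α g) -ractlr.
- by rewrite -[in RHS](twiK α g) ractrA.
- exact: rcoact_actr.
Qed.
Definition rcb_runit := sval rcb_runit_sig.
Lemma rcb_runitE (m : M) (h : U) : rcb_runit (m ⊗[M, U] h) = actr m h.
Proof. exact: (svalP rcb_runit_sig). Qed.

Lemma rcb_lunit_iso : @is_iso (rcb_category H) _ _ rcb_lunit.
Proof.
apply: (@rcb_hom_iso _ _ _ _ rcb_lunit (fun m => one ⊗[U, M] twi (rμ M) m)).
- by lin.
- move=> t; ht_ind t (hopf_rcb H) M h m; rewrite rcb_lunitE ractl_twi.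
  (* Writing [one] as its own twist lets the balancing relation, read backwards, move [αV h] to the
     first factor, where [one] times [αV h] is [h]. *)
  by rewrite -{1}hone_tw -U_tw -htens_swap U_actr hmul1r twiK.
- by move=> m; rewrite rcb_lunitE ract1l twiK.
Qed.

Lemma rcb_runit_iso : @is_iso (rcb_category H) _ _ rcb_runit.
Proof.
apply: (@rcb_hom_iso _ _ _ _ rcb_runit (fun m => twi (rμ M) m ⊗[M, U] one)).
- by lin.
- move=> t; ht_ind t M (hopf_rcb H) m h; rewrite rcb_runitE ractr_twi.
  rewrite htens_swap U_actl -[twi (rμ U) one]/(αV one).
  by rewrite hone_twi hmulr1 !twiK.
- by move=> m; rewrite rcb_runitE ractr1 twiK.
Qed.
End Units.

(** * The associativity constraint and its inverse *)

Section Associator.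
Variables M N P : rcb H.
Local Notation μ := (rμ M).
Local Notation π := (rμ P).
Local Notation μV := (twi (rμ M)).
Local Notation πV := (twi (rμ P)).
Local Notation MN := (ht_rcb M N).
Local Notation NP := (ht_rcb N P).

(** The variable [p] comes first, as a parameter, while the map descends to the inner tensor product
    of [M] and [N]. *)
Definition assoc_gen (p : P) (m : M) (n : N) : ht_rcb M NP :=
  μ m ⊗[M, NP] (n ⊗[N, P] πV p).

Lemma assoc_gen_bilinear p : bilinear_map (assoc_gen p).
Proof. by rewrite /assoc_gen; lin. Qed.
(** The outer relation moves [α h] onto [NP], whose left action makes it fall on the factor in [N]
    as [h]. *)
Lemma assoc_gen_balanced p : balanced (assoc_gen p).
Proof.
move=> m h n; rewrite /assoc_gen ractr_tw htens_swap rht_twi rht_actl.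
by rewrite twiK twfK.
Qed.

Definition assoc_fun (t : MN) (p : P) : ht_rcb M NP := hlift (assoc_gen p) t.

Lemma assoc_funE m n p : assoc_fun (m ⊗[M, N] n) p = assoc_gen p m n.
Proof. exact: hliftE (assoc_gen_bilinear p) (assoc_gen_balanced p) _ _. Qed.

Lemma assoc_bilinear : bilinear_map assoc_fun.
Proof.
suff [l r] : bilinear_map (fun p t => assoc_fun t p) by split.
apply: hlift_bilinear => [m n|p|p]; last exact: assoc_gen_balanced.
  by rewrite /assoc_gen; lin.
exact: assoc_gen_bilinear.
Qed.
#[local] Hint Extern 0 (bilinear_map assoc_fun) =>
  exact: assoc_bilinear : bilinear.

(** Here the relation that applies is the inner one, between [N] and [P]. *)
Lemma assoc_balanced : balanced assoc_fun.
Proof.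
move=> t h p; ht_ind t M N m n.
rewrite rht_actr rht_tw !assoc_funE /assoc_gen htens_swap.
by rewrite ractl_twi.
Qed.

Lemma rcb_assoc_sig : {F : rcb_hom (ht_rcb MN P) (ht_rcb M NP) |
  forall (m : M) (n : N) (p : P),
    F ((m ⊗[M, N] n) ⊗[MN, P] p) = μ m ⊗[M, NP] (n ⊗[N, P] πV p)}.
Proof.
(* [hlift_hom] sees only the outer tensor product, so the first factor is first an arbitrary [t]. *)
suff [F FE] : {F : rcb_hom (ht_rcb MN P) (ht_rcb M NP) |
    forall (t : MN) (p : P), F (t ⊗[MN, P] p) = assoc_fun t p}.
  by exists F => m n p; rewrite FE assoc_funE.
refine (hlift_hom assoc_bilinear assoc_balanced _ _ _ _)
  => [t p|h t p|h t p|t p];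
  ht_ind t M N m n.
- by rewrite rht_tw !assoc_funE /assoc_gen !rht_tw twiK twfK.
- rewrite rht_actl !assoc_funE /assoc_gen rht_actl rht_tw ractl_tw.
  by rewrite twfK !twiK.
- rewrite rht_tw !assoc_funE /assoc_gen rht_actr rht_actr.
  by rewrite ractr_twi.
(* Colinearity comes down to [α m1 (n1 (αV p1)) = (m1 n1) p1]. *)
- rewrite assoc_funE /assoc_gen !rht_coact rcoact_tw rcoact_twi.
  move: (coact M m) (coact N n) (coact P p) => s u v.
  tens_ind s m0 m1; tens_ind u n0 n1; tens_ind v p0 p1; tE.
  by rewrite assoc_funE /assoc_gen hmulA twiK.
Qed.
Definition rcb_assoc := sval rcb_assoc_sig.
Lemma rcb_assocE (m : M) (n : N) (p : P) :
  rcb_assoc ((m ⊗[M, N] n) ⊗[MN, P] p) = μ m ⊗[M, NP] (n ⊗[N, P] πV p).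
Proof. exact: (svalP rcb_assoc_sig). Qed.

Definition assocV_gen (m : M) (n : N) (p : P) : ht_rcb MN P :=
  (μV m ⊗[M, N] n) ⊗[MN, P] π p.

Lemma assocV_gen_bilinear m : bilinear_map (assocV_gen m).
Proof. by rewrite /assocV_gen; lin. Qed.
Lemma assocV_gen_balanced m : balanced (assocV_gen m).
Proof.
(* With [h] as [αV (α h)] and [μV m] as a twist, the first factor becomes a right action of [α h] on
   [MN], and the outer relation applies. *)
move=> n h p; rewrite /assocV_gen -[h in LHS](twfK α).
rewrite -(twiK μ (μV m)) -rht_actr htens_swap rht_tw.
by rewrite ractl_tw !twfK !twiK.
Qed.

Definition assocV_fun (m : M) (t : NP) : ht_rcb MN P := hlift (assocV_gen m) t.

Lemma assocV_funE m n p : assocV_fun m (n ⊗[N, P] p) = assocV_gen m n p.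
Proof. exact: hliftE (assocV_gen_bilinear m) (assocV_gen_balanced m) _ _. Qed.

Lemma assocV_bilinear : bilinear_map assocV_fun.
Proof.
apply: hlift_bilinear => [n p|m|m]; last exact: assocV_gen_balanced.
  by rewrite /assocV_gen; lin.
exact: assocV_gen_bilinear.
Qed.
#[local] Hint Extern 0 (bilinear_map assocV_fun) =>
  exact: assocV_bilinear : bilinear.

Lemma assocV_balanced : balanced assocV_fun.
Proof.
move=> m h t; ht_ind t N P n p.
rewrite rht_twi rht_actl !assocV_funE /assocV_gen.
by rewrite ractr_twi htens_swap twfK !twiK.
Qed.

Definition rcb_assocV (t : ht_rcb M NP) : ht_rcb MN P := hlift assocV_fun t.

Lemma rcb_assocVE (m : M) (n : N) (p : P) :
  rcb_assocV (m ⊗[M, NP] (n ⊗[N, P] p)) = (μV m ⊗[M, N] n) ⊗[MN, P] π p.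
Proof.
rewrite -[RHS]assocV_funE.
exact: hliftE assocV_bilinear assocV_balanced _ _.
Qed.

Lemma rcb_assocV_linear : linear rcb_assocV.
Proof. exact: hlift_linear assocV_bilinear assocV_balanced. Qed.

Lemma rcb_assoc_iso : @is_iso (rcb_category H) _ _ rcb_assoc.
Proof.
have Vl := rcb_assocV_linear.
apply: (@rcb_hom_iso _ _ _ _ rcb_assoc rcb_assocV) => // t.
- ht_ind t (ht_rcb M N) P s p; ht_ind s M N m n.
  by rewrite rcb_assocE rcb_assocVE twfK twiK.
- ht_ind t M (ht_rcb N P) m s; ht_ind s N P n p.
  by rewrite rcb_assocVE rcb_assocE twfK twiK.
Qed.

End Associator.

End Constraints.

(** * The axioms of a tensor category *)

Section TensorCategory.
Variables (k : comPzRingType) (H : hom_hopf k).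
Local Notation C := (rcb_category H).
Local Notation T := (@ht_rcb k H).
Local Notation U := (hopf_rcb H).

Lemma rcb_compE (M N P : C) (g : chom N P) (f : chom M N) t :
  rhom (g ∘ f) t = rhom g (rhom f t).
Proof. by []. Qed.
Lemma rcb_idE (M : C) t : rhom (cid M) t = t.
Proof. by []. Qed.

Lemma rcb_is_tensor_category :
  is_tensor_category C U T (@rcb_tmor k H) (@rcb_assoc k H)
    (@rcb_lunit k H) (@rcb_runit k H).
Proof.
split.
- move=> X Y; apply: rcb_hom_ext => t; ht_ind t X Y x y.
  by rewrite rcb_tmorE !rcb_idE.
- move=> X X' X'' Y Y' Y'' f f' g g'; apply: rcb_hom_ext => t; ht_ind t X Y x y.
  by rewrite rcb_compE !rcb_tmorE.
- exact: rcb_assoc_iso.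
- move=> X X' Y Y' Z Z' f g h; apply: rcb_hom_ext => t.
  ht_ind t (ht_rcb X Y) Z s z; ht_ind s X Y x y.
  by rewrite !rcb_compE !(rcb_tmorE, rcb_assocE) (hom_twist (rhomP f)) rhom_twi.
- exact: rcb_lunit_iso.
- move=> X Y f; apply: rcb_hom_ext => t; ht_ind t (hopf_rcb H) X h x.
  by rewrite !rcb_compE rcb_tmorE !rcb_lunitE (hom_actl (rhomP f)).
- exact: rcb_runit_iso.
- move=> X Y f; apply: rcb_hom_ext => t; ht_ind t X (hopf_rcb H) x h.
  by rewrite !rcb_compE rcb_tmorE !rcb_runitE (hom_actr (rhomP f)).
- move=> X Y Z W; apply: rcb_hom_ext => t.
  ht_ind t (ht_rcb (ht_rcb X Y) Z) W s w; ht_ind s (ht_rcb X Y) Z u z; ht_ind u X Y x y.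
  (* Both composites twist [x] twice and [y] once, and apply the inverse twist once to [z] and twice
     to [w]. *)
  rewrite !rcb_compE rcb_tmorE 2!rcb_assocE rcb_tmorE rcb_assocE.
  rewrite (@rcb_assocE k H (T X Y) Z W (x ⊗[X, Y] y) z w) rht_tw rcb_assocE.
  by rewrite rht_twi.
- move=> X Y; apply: rcb_hom_ext => t.
  ht_ind t (ht_rcb X (hopf_rcb H)) Y s y; ht_ind s X (hopf_rcb H) x h.
  (* On simple tensors the triangle becomes the balancing relation itself. *)
  rewrite !rcb_compE !(rcb_tmorE, rcb_assocE) rcb_lunitE rcb_runitE.
  by rewrite htens_swap.
Qed.

End TensorCategory.

Theorem theorem5p4 (k : comPzRingType) (H : hom_hopf k) :
  exists st : forall M N : rcb H, rcb_struct H (htensor M N),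
    let T (M N : rcb H) : rcb H := Rcb (st M N) in
    let U : rcb H := hopf_rcb H in
    let αV := twi (htw H) in
    [/\ forall (M N : rcb H) (m : M) (n : N),
          rμ (T M N) (m ⊗[M, N] n) = rμ M m ⊗[M, N] rμ N n,
        forall (M N : rcb H) (h : H) (m : M) (n : N),
          @actl k H (T M N) h (m ⊗[M, N] n)
          = actl (αV h) m ⊗[M, N] rμ N n,
        forall (M N : rcb H) (m : M) (n : N) (h : H),
          @actr k H (T M N) (m ⊗[M, N] n) h
          = rμ M m ⊗[M, N] actr n (αV h),
        forall (M N : rcb H) (m : M) (n : N),
          coact (T M N) (m ⊗[M, N] n)
          = \tsum_(m0, m1 <- coact M m) \tsum_(n0, n1 <- coact N n)
              ((m0 ⊗[M, N] n0 : T M N) ⊗ hmul m1 n1)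
      & exists (tmor : forall M M' N N' : rcb H,
                  rcb_hom M M' -> rcb_hom N N' -> rcb_hom (T M N) (T M' N'))
               (a : forall M N P : rcb H, rcb_hom (T (T M N) P) (T M (T N P)))
               (l : forall M : rcb H, rcb_hom (T U M) M)
               (r : forall M : rcb H, rcb_hom (T M U) M),
          [/\ forall (M M' N N' : rcb H) (f : rcb_hom M M') (g : rcb_hom N N')
                     (m : M) (n : N),
                tmor M M' N N' f g (m ⊗[M, N] n) = f m ⊗[M', N'] g n,
              forall (M N P : rcb H) (m : M) (n : N) (p : P),
                a M N P ((m ⊗[M, N] n) ⊗[T M N, P] p)
                = rμ M m ⊗[M, T N P] (n ⊗[N, P] twi (rμ P) p),
              forall (M : rcb H) (h : H) (m : M),
                l M (h ⊗[U, M] m) = actl h m,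
              forall (M : rcb H) (m : M) (h : H),
                r M (m ⊗[M, U] h) = actr m h
            & is_tensor_category (rcb_category H) U T tmor a l r]].
Proof.
exists (@ht_struct k H); split.
- exact: rht_tw.
- exact: rht_actl.
- by move=> M N m n h; exact: rht_actr.
(* [tprod2] unfolds to the double Sweedler sum. *)
- exact: rht_coact.
exists (@rcb_tmor k H), (@rcb_assoc k H), (@rcb_lunit k H), (@rcb_runit k H); split.
- exact: rcb_tmorE.
- exact: rcb_assocE.
- exact: rcb_lunitE.
- exact: rcb_runitE.
- exact: rcb_is_tensor_category.
Qed.
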